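(* Let $P$ be the transition kernel of a $\pi$-irreducible Markov chain that is reversible with respect to its invariant probability measure $\pi$ and non-negative definite, and assume that there exists an accessible atom $A$ such that $M:=\sup_{x\in X}\mathbb{E}_x[\sigma_A]<\infty$. Let $\widetilde P$ be a transition kernel on the same space with invariant probability measure $\widetilde\pi$. Then for all $1<\lambda<e^{1/M}$ and $n\ge1$, $$\|\widetilde P^n-P^n\|\le\Bigl\{\frac{e^{1/M}}{e^{1/M}-1}D_1(1-e^{-n/M})+\frac{\lambda}{\lambda-1}E_1(1-\lambda^{-n})\Bigr\}\|\widetilde P-P\|,$$ and $$\|\widetilde\pi-\pi\|_{\mathrm{Var}}\le\Bigl\{\frac{e^{1/M}}{e^{1/M}-1}D_1+\frac{\lambda}{\lambda-1}E_1\Bigr\}\|\widetilde P-P\|,$$ where $$D_1=C_1\Bigl(1-\frac{e^{1/M}-1}{e^{1/M}-\lambda}M_1\Bigr),\qquad E_1=M_1\Bigl((2-C_1)^+\lambda^{-1}+\frac{e^{1/M}-1}{e^{1/M}-\lambda}C_1\Bigr),$$ $$C_1=\bigl(\pi(A)^{-1}-1\bigr)^{1/2},\qquad M_1=\lambda(1-M\log\lambda)^{-1}.$$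
   Context: $\Phi=\{\Phi_n:n\in\mathbb{Z}_+\}$ is a discrete-time homogeneous Markov chain on a general state space $X$ with countably generated $\sigma$-field $\mathscr{B}(X)$ and $n$-step transition kernel $P^n(x,B)=\mathbb{P}_x\{\Phi_n\in B\}$; $\mathbb{P}_x,\mathbb{E}_x$ are probability and expectation given $\Phi_0=x$. The chain has a (unique) invariant probability measure $\pi$ and is $\pi$-irreducible: if $\pi(B)>0$, there exists $n\in\mathbb{N}$ such that $P^n(x,B)>0$ for all $x\in X$. It is assumed that $P^n(x,\cdot)\ll\pi$ ($n\ge1$), with density $p^n(x,y)$. Reversible: $\pi(dx)P(x,dy)=\pi(dy)P(y,dx)$. Non-negative definite: $\int_X f(x)Pf(x)\,\pi(dx)\ge0$ for all $f\in L^2(\pi,X)$, where $Pf(x)=\int f(y)P(x,dy)$. A set $A\in\mathscr{B}(X)$ is an atom if there is a probability measure $\nu$ on $\mathscr{B}(X)$ with $P(x,B)=\nu(B)$ for all $x\in A$, $B\in\mathscr{B}(X)$; it is an accessible atom if moreover $\pi(A)>0$. $\sigma_A=\inf\{n\ge0:\Phi_n\in A\}$. For a signed measure $\mu$, $\|\mu\|_{\mathrm{Var}}=\sup_{|f|\le1}|\mu(f)|$; $\|\widetilde P^n-P^n\|=\sup_{x\in X}\|\widetilde P^n(x,\cdot)-P^n(x,\cdot)\|_{\mathrm{Var}}$. $a^+=\max\{a,0\}$. *)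

(* Defs.v *)
From HB Require Import structures.
From mathcomp Require Import all_boot all_order all_algebra.
From mathcomp Require Import all_classical all_reals all_analysis.
Import Order.TTheory GRing.Theory Num.Theory.
Import numFieldNormedType.Exports.

Set Implicit Arguments.
Unset Strict Implicit.
Unset Printing Implicit Defensive.

Local Open Scope classical_set_scope.
Local Open Scope ring_scope.
Local Open Scope ereal_scope.

Section kernels.
Context d (X : measurableType d) (R : realType).
Implicit Types (P : R.-pker X ~> X) (p : probability X R) (A B : set X).

Definition countably_generated : Prop :=
  exists2 G : set (set X), countable G & @measurable d X = <<s G >>.

(* The library composes subprobability kernels, hence the type; the iterates of
   a probability kernel are of course probability kernels. *)
Fixpoint kpow P (n : nat) : R.-spker X ~> X :=
  if n is m.+1 then mkcomp_noparam P (kpow P m)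
  else kdirac (@measurable_id _ X setT).

Definition invariant_measure P p : Prop :=
  forall B, measurable B -> \int[p]_x P x B = p B.

(* The set B must be reachable from every point, at a time which may depend on
   the point. *)
Definition irreducible P p : Prop :=
  forall B, measurable B -> 0 < p B ->
    forall x, exists2 n : nat, (0 < n)%N & 0 < kpow P n x B.

(* p(dx) P(x, dy) = p(dy) P(y, dx) as measures on X * X. *)
Definition reversible P p : Prop :=
  forall C : set (X * X), measurable C ->
    \int[p]_x P x (xsection C x) = \int[p]_y P y (ysection C y).

Definition nonneg_definite P p : Prop :=
  forall f : X -> R, f \in Lfun p 2%:E ->
    0 <= \int[p]_x ((f x)%:E * \int[P x]_y (f y)%:E).

Definition atom P A : Prop :=
  measurable A /\
  exists nu : probability X R,
    forall x, A x -> forall B, measurable B -> P x B = nu B.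

Definition accessible_atom P p A : Prop := atom P A /\ 0 < p A.

(* The norm ||mu - nu||_Var = sup_(|f| <= 1) |(mu - nu)(f)| of the signed
   measure mu - nu, for finite measures mu and nu. *)
Definition var_dist (mu nu : {measure set X -> \bar R}) : \bar R :=
  ereal_sup [set `| \int[mu]_x (f x)%:E - \int[nu]_x (f x)%:E |
            | f in [set f : X -> R |
                     measurable_fun setT f /\ forall x, (`|f x| <= 1)%R]].

Definition kernel_dist (K L : X -> {measure set X -> \bar R}) : \bar R :=
  ereal_sup (range (fun x => var_dist (K x) (L x))).

Section chains.
Context d' (Omega : measurableType d').
Implicit Types (Phi : nat -> Omega -> X).

Definition past Phi (n : nat) : set (set Omega) :=
  <<s \bigcup_(k in [set k | (k <= n)%N])
        preimage_set_system setT (Phi k) measurable >>.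

(* PP x is the probability given Phi 0 = x. The last field says that
   P (Phi n) B is a version of the conditional probability of
   [Phi n.+1 \in B] given Phi 0, ..., Phi n. *)
Record markov_chain P (PP : X -> probability Omega R) Phi : Prop := MarkovChain {
  chain_measurable : forall n, measurable_fun setT (Phi n) ;
  chain_start : forall x B, measurable B -> PP x (Phi 0%N @^-1` B) = dirac x B ;
  chain_step : forall x n E B, past Phi n E -> measurable B ->
    PP x (E `&` Phi n.+1 @^-1` B) = \int[PP x]_(w in E) P (Phi n w) B }.

(* First hitting time, +oo if A is never visited. *)
Definition hitting_time Phi A (w : Omega) : \bar R :=
  ereal_inf [set n%:R%:E | n in [set n | A (Phi n w)]].

End chains.

End kernels.

Section constants.
Local Open Scope ring_scope.
Context d (X : measurableType d) (R : realType).
Variables (p : probability X R) (A : set X) (M lam : R).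

Definition C1 : R := Num.sqrt ((fine (p A))^-1 - 1).

Definition M1 : R := lam * (1 - M * ln lam)^-1.

Definition D1 : R :=
  C1 * (1 - (expR M^-1 - 1) / (expR M^-1 - lam) * M1).

Definition E1 : R :=
  M1 * (Num.max (2 - C1) 0 * lam^-1
        + (expR M^-1 - 1) / (expR M^-1 - lam) * C1).

End constants.

(* Main.v *)
(** Write [rho = e^(-1/M)], [mu = 1/lam], and let [Q f = 1_(A^c) P f], so that
    [Q^n 1 (x)] is the probability [P_x(sigma_A >= n)].
    The truncated means [w(x) = E_x(min(sigma_A, N))] are almost superharmonic
    for [Q], which by AM-GM and reversibility bounds the quadratic form
    [<g, P g>] by [(1 - 1/M) |g|^2] for [g] vanishing on [A]. Since [P f] is
    constant on an atom, the same bound follows for centred functions that are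
    constant on [A], and non-negative definiteness turns it into
    [|P f| <= rho |f|]. Applied to [1_A / pi(A) - 1], of norm [C1], this gives
    [|P^n f(x) - pi(f)| <= C1 rho^n] for [x] in [A], [n >= 1] and [|f| <= 1].
    Decomposing at the first entrance to [A], and using
    [P_x(sigma_A >= n) <= mu^n / (1 - M ln lam)], one gets
    [|P^n f(x) - pi(f)| <= D1 rho^n + E1 mu^n] for all [x] and [n]. The theorem
    follows by telescoping [Pt^n - P^n = sum_i Pt^(n-1-i) (Pt - P) (P^i - pi)]. *)

Require Import Defs.
From HB Require Import structures.
From mathcomp Require Import all_boot all_order all_algebra.
From mathcomp Require Import all_classical all_reals all_analysis.
From mathcomp Require Import measurable_realfun ring lra.
Import Order.TTheory GRing.Theory Num.Theory.
Import numFieldNormedType.Exports.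

Set Implicit Arguments.
Unset Strict Implicit.
Unset Printing Implicit Defensive.

Local Open Scope classical_set_scope.
Local Open Scope ring_scope.

(** * Bounded measurable functions and induction on them *)

Section bounded_measurable.
Context d (T : measurableType d) (R : realType).
Implicit Types f g : T -> R.

Definition bmf f : Prop :=
  measurable_fun setT f /\ exists C, forall x, `|f x| <= C.

Lemma bmfD f g : bmf f -> bmf g -> bmf (fun x => f x + g x).
Proof.
move=> [mf [C hC]] [mg [D hD]]; split; first exact: measurable_funD.
by exists (C + D) => x; rewrite (le_trans (ler_normD _ _))// lerD.
Qed.

Lemma bmfM f g : bmf f -> bmf g -> bmf (fun x => f x * g x).
Proof.
move=> [mf [C hC]] [mg [D hD]]; split; first exact: measurable_funM.
by exists (C * D) => x; rewrite normrM ler_pM.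
Qed.

Lemma bmf_cst a : bmf (fun=> a).
Proof. by split; [exact: measurable_cst|exists `|a|]. Qed.

Lemma bmfZ a f : bmf f -> bmf (fun x => a * f x).
Proof. exact/bmfM/bmf_cst. Qed.

Lemma bmfB f g : bmf f -> bmf g -> bmf (fun x => f x - g x).
Proof.
move=> hf /(bmfZ (-1)) hg; have := bmfD hf hg.
by congr bmf; apply/funext => x; rewrite mulN1r.
Qed.

Lemma bmf_indic (B : set T) : measurable B -> bmf (\1_B).
Proof.
move=> mB; split; first exact: measurable_indic.
by exists 1 => x; rewrite indicE; case: (_ \in _); rewrite ?normr1 ?normr0 ?ler01.
Qed.

Lemma bmf_norm f : bmf f -> bmf (fun x => `|f x|).
Proof.
move=> [mf [C hC]]; split; first exact: measurableT_comp.
by exists C => x; rewrite normr_id.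
Qed.

Lemma bmf_sum n (F : nat -> T -> R) : (forall i, (i < n)%N -> bmf (F i)) ->
  bmf (fun x => \sum_(i < n) F i x).
Proof.
elim: n => [_|n ih h].
  have := bmf_cst 0; congr bmf; apply/funext => x; by rewrite big_ord0.
have := bmfD (ih (fun i hi => h i (ltnW hi))) (h n (ltnSn n)).
by congr bmf; apply/funext => x; rewrite big_ord_recr.
Qed.

(** Any bounded measurable function is within [e] of a finite staircase built from indicators of its
    superlevel sets, so stability under linear combinations and uniform limits suffices. *)
Lemma bmf_ind (Q : (T -> R) -> Prop) :
  (forall B, measurable B -> Q (\1_B)) ->
  (forall a f g, bmf f -> bmf g -> Q f -> Q g -> Q (fun x => a * f x + g x)) ->
  (forall f, bmf f -> (forall e, 0 < e ->
     exists2 g, bmf g & Q g /\ forall x, `|f x - g x| <= e) -> Q f) ->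
  forall f, bmf f -> Q f.
Proof.
move=> Q1 Qlin Qlim f bf.
have [mf [C hC]] := bf.
have bset (t : R) : measurable [set x | t <= f x].
  rewrite [X in measurable X](_ : _ = setT `&` f @^-1` `[t, +oo[).
    by apply: (mf measurableT); exact: measurable_itv.
  by apply/seteqP; split=> x /=; rewrite in_itv/= andbT// => -[].
have Q0 : Q (fun=> 0).
  have := Q1 _ (@measurable0 _ T); congr Q; by apply/funext => x; rewrite indicE in_set0.
have Qc a : Q (fun=> a).
  have := Qlin a _ _ (bmf_indic (@measurableT _ T)) (bmf_cst 0) (Q1 _ (@measurableT _ T)) Q0.
  by congr Q; apply/funext => x; rewrite indicT mulr1 addr0.
apply: Qlim => // e e0.
(* A staircase below [f]: from the lower bound [- C] it climbs by [e] for each of the first [n]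
   levels that [f] reaches. *)
pose g n x := - C + e * \sum_(i < n) (\1_[set x | - C + i.+1%:R * e <= f x] x : R).
have gE n x : g n.+1 x =
    e * \1_[set x | - C + n.+1%:R * e <= f x] x + g n x.
  by rewrite /g big_ord_recr/= mulrDr; ring.
have bg n : bmf (g n).
  apply: bmfD; first exact: bmf_cst.
  apply: bmfZ; apply: (@bmf_sum n (fun i => \1_[set x | - C + i.+1%:R * e <= f x])) => i _.
  exact: bmf_indic.
have Qg n : Q (g n).
  elim: n => [|n ih].
    have := Qc (- C); congr Q; apply/funext => x.
    by rewrite /g big_ord0 mulr0 addr0.
  rewrite (funext (gE n)).
  exact: (Qlin _ _ _ (bmf_indic (bset _)) (bg n) (Q1 _ (bset _)) ih).
(* Enough levels for the top [- C + m%:R * e] of the staircase to exceed the upper bound [C] of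
   [f]. *)
pose m := Num.bound ((C + C) / e).
exists (g m) => //; split => // x.
(* Either the staircase is within [e] of [f], or it has climbed all of its [n] levels. *)
have bd n : g n x <= f x /\ (f x <= g n x + e \/ g n x = - C + n%:R * e).
  elim: n => [|n [ih1 ih2]].
    rewrite /g big_ord0 mulr0 addr0 mul0r addr0; split; last by right.
    by have := hC x; rewrite ler_norml => /andP[].
  rewrite gE indicE; case: (boolP (x \in _)) => /=.
    rewrite inE/= mulr1 => h; rewrite mulrSr mulrDl mul1r in h *.
    case: ih2 => ih2; last by rewrite ih2; split; [lra|right; lra].
    have [h1|h1] := leP (e + g n x) (f x); first by split=> //; left; lra.
    exfalso.
    have : g n x <= - C + n%:R * e.
      rewrite /g lerD2l mulrC ler_wpM2r ?(ltW e0)//.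
      apply: (@le_trans _ _ (\sum_(i < n) 1)); last by rewrite sumr_const card_ord.
      by apply: ler_sum => i _; rewrite indicE; case: (_ \in _).
    lra.
  rewrite mulr0 add0r notin_setE/= => /negP; rewrite -ltNge => h.
  split=> //; left; case: ih2 => [//|->].
  by apply/ltW/(lt_le_trans h); rewrite mulrSr; lra.
have [b1 [b2|b2]] := bd m; rewrite ger0_norm ?subr_ge0//; first by lra.
have : (C + C) / e < m%:R.
  rewrite /m; apply: le_lt_trans (archi_boundP _); rewrite ?lexx//.
  rewrite divr_ge0 ?(ltW e0)// addr_ge0// (le_trans _ (hC x))//.
rewrite ltr_pdivrMr// => h.
have := hC x; rewrite ler_norml => /andP[_ h2]; lra.
Qed.

End bounded_measurable.

(** * Real-valued integrals of bounded functions for measures of mass at most one *)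

Section bounded_integral.
Context d (T : measurableType d) (R : realType).
Variable mu : {measure set T -> \bar R}.
Hypothesis mu1 : (mu setT <= 1)%E.
Implicit Types f g : T -> R.

Lemma bmf_integrable f : bmf f -> mu.-integrable setT (EFin \o f).
Proof.
move=> [mf [C hC]]; apply: measurable_bounded_integrable => //.
  by rewrite (le_lt_trans mu1)// ltry.
exists C; split; first exact: num_real.
by move=> M CM x _; apply: le_trans (hC x) (ltW CM).
Qed.

Lemma EFin_Rintegral f : bmf f ->
  (\int[mu]_x f x)%:E = (\int[mu]_x (f x)%:E)%E.
Proof. by move=> bf; rewrite fineK//; exact: integrable_fin_num (bmf_integrable bf). Qed.

Lemma bRintegralD f g : bmf f -> bmf g ->
  \int[mu]_x (f x + g x) = \int[mu]_x f x + \int[mu]_x g x.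
Proof. by move=> bf bg; rewrite RintegralD//; exact: bmf_integrable. Qed.

Lemma bRintegralB f g : bmf f -> bmf g ->
  \int[mu]_x (f x - g x) = \int[mu]_x f x - \int[mu]_x g x.
Proof. by move=> bf bg; rewrite RintegralB//; exact: bmf_integrable. Qed.

Lemma bRintegralZ a f : bmf f -> \int[mu]_x (a * f x) = a * \int[mu]_x f x.
Proof. by move=> bf; rewrite RintegralZl//; exact: bmf_integrable. Qed.

Lemma bRintegral_le f g : bmf f -> bmf g -> (forall x, f x <= g x) ->
  \int[mu]_x f x <= \int[mu]_x g x.
Proof. by move=> bf bg fg; apply: le_Rintegral => //; exact: bmf_integrable. Qed.

Lemma Rintegral_indic B : measurable B -> \int[mu]_x \1_B x = fine (mu B).
Proof. by move=> mB; rewrite /Rintegral integral_indic// setIT. Qed.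

Lemma mu_le1_fin_num B : measurable B -> (mu B \is a fin_num).
Proof.
move=> mB; rewrite ge0_fin_numE// (@le_lt_trans _ _ 1%E) ?ltry//.
by rewrite (le_trans _ mu1)// le_measure// inE.
Qed.

Lemma fine_mu_le1 B : measurable B -> 0 <= fine (mu B) <= 1.
Proof.
move=> mB; have h : (mu B <= 1)%E.
  by rewrite (le_trans _ mu1)// le_measure// inE.
by rewrite fine_ge0//= -lee_fin fineK// mu_le1_fin_num.
Qed.

Lemma bRintegral_norm_le f C : bmf f -> (forall x, `|f x| <= C) -> 0 <= C ->
  `|\int[mu]_x f x| <= C.
Proof.
move=> bf fC C0.
apply: (le_trans (le_normr_Rintegral _ (bmf_integrable bf))) => //.
apply: (@le_trans _ _ (\int[mu]_x C)).
  apply: bRintegral_le => //; [exact: bmf_norm|exact: bmf_cst].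
rewrite Rintegral_cst// ler_piMr//.
by have /andP[] := fine_mu_le1 (@measurableT _ T).
Qed.

Lemma bRintegral_abs_le f : bmf f ->
  `|\int[mu]_x f x| <= \int[mu]_x `|f x|.
Proof. by move=> bf; apply: le_normr_Rintegral => //; exact: bmf_integrable. Qed.

Lemma bRintegral_dist_le f g C : bmf f -> bmf g -> 0 <= C ->
  (forall x, `|f x - g x| <= C) ->
  `|\int[mu]_x f x - \int[mu]_x g x| <= C.
Proof.
move=> bf bg C0 h; rewrite -bRintegralB//.
by apply: bRintegral_norm_le => //; exact: bmfB.
Qed.

End bounded_integral.

(** * Linear functionals and operators bounded in the sup norm *)

Definition bfunctional d (X : measurableType d) (R : realType) (F : (X -> R) -> R) : Prop :=
  (forall a f g, bmf f -> bmf g -> F (fun x => a * f x + g x) = a * F f + F g) /\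
  exists2 c, 0 <= c & forall f e, bmf f -> 0 <= e -> (forall x, `|f x| <= e) ->
    `|F f| <= c * e.

Definition boperator d d' (X : measurableType d) (Y : measurableType d')
    (R : realType) (L : (Y -> R) -> X -> R) : Prop :=
  [/\ forall f, bmf f -> bmf (L f),
      forall a f g, bmf f -> bmf g ->
        L (fun y => a * f y + g y) = (fun x => a * L f x + L g x) &
      exists2 c, 0 <= c & forall f e, bmf f -> 0 <= e ->
        (forall y, `|f y| <= e) -> forall x, `|L f x| <= c * e].

Definition kop d d' (X : measurableType d) (Y : measurableType d') (R : realType)
    (K : X -> {measure set Y -> \bar R}) (f : Y -> R) (x : X) : R :=
  \int[K x]_y f y.

Section bounded_functionals.
Context d d' (X : measurableType d) (Y : measurableType d') (R : realType).

(** Both functionals are continuous for uniform convergence, so [bmf_ind] applies to their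
    agreement. Through this lemma the identities assumed for sets are transferred to functions. *)
Lemma bfunctional_ext (F G : (X -> R) -> R) : bfunctional F -> bfunctional G ->
  (forall B, measurable B -> F (\1_B) = G (\1_B)) ->
  forall f, bmf f -> F f = G f.
Proof.
move=> [Fl [c c0 Fb]] [Gl [c' c'0 Gb]] h; apply: bmf_ind => //.
  by move=> a f g bf bg hf hg; rewrite Fl// Gl// hf hg.
move=> f bf happ; apply/eqP; rewrite -subr_eq0 -normr_le0.
apply/ler_addgt0Pr => e e0; rewrite add0r.
(* The summand 1 keeps [C] positive, and [(c + c') * (e / C) <= e]. *)
pose C := c + c' + 1.
have C0 : 0 < C by rewrite ltr_wpDl// addr_ge0.
have eC0 : 0 < e / C by rewrite divr_gt0.
have [g bg [FGg hg]] := happ _ eC0.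
have bfg := bmfB bf bg.
have subE (H : (X -> R) -> R) :
    (forall a f g, bmf f -> bmf g -> H (fun x => a * f x + g x) = a * H f + H g) ->
    H (fun x => f x - g x) = H f - H g.
  move=> Hl; rewrite [X in H X](_ : _ = fun x => (-1) * g x + f x).
    by rewrite Hl// mulN1r addrC.
  by apply/funext => x; rewrite mulN1r addrC.
have Fe := Fb _ _ bfg (ltW eC0) hg; have Ge := Gb _ _ bfg (ltW eC0) hg.
rewrite (subE F Fl) in Fe; rewrite (subE G Gl) -FGg in Ge.
have -> : F f - G f = (F f - F g) - (G f - F g) by ring.
rewrite (le_trans (ler_normB _ _))// (le_trans (lerD Fe Ge))// -mulrDl.
by rewrite mulrCA ler_piMr ?(ltW e0)// ler_pdivrMr// mul1r lerDl.
Qed.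

Lemma bfunctional_comp (F : (X -> R) -> R) (L : (Y -> R) -> X -> R) :
  bfunctional F -> boperator L -> bfunctional (fun f => F (L f)).
Proof.
move=> [Fl [c c0 Fb]] [Lb Ll [c' c'0 Lc]]; split.
  by move=> a f g bf bg; rewrite Ll// Fl//; exact: Lb.
exists (c * c'); first exact: mulr_ge0.
move=> f e bf e0 fe; rewrite -mulrA; apply: Fb; first exact: Lb.
  exact: mulr_ge0.
exact: Lc.
Qed.

Lemma bfunctional_integral (mu : {measure set X -> \bar R}) :
  (mu setT <= 1)%E -> bfunctional (fun f => \int[mu]_x f x).
Proof.
move=> mu1; split.
  by move=> a f g bf bg; rewrite bRintegralD ?bRintegralZ//; exact: bmfZ.
by exists 1 => // f e bf e0 fe; rewrite mul1r bRintegral_norm_le.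
Qed.

Lemma boperator_comp (h : X -> Y) : measurable_fun setT h ->
  boperator (fun (f : Y -> R) x => f (h x)).
Proof.
move=> mh; split => //.
  move=> f [mf [C hC]]; split; first exact: measurableT_comp.
  by exists C => x; exact: hC.
by exists 1 => // f e _ _ fe x; rewrite mul1r.
Qed.

Variable K : R.-spker X ~> Y.

Let K1 x : (K x setT <= 1)%E := sprob_kernel_le1 K x.

Lemma bmf_kop f : bmf f -> bmf (kop K f).
Proof.
move=> bf; have [mf [C hC]] := bf; split; last first.
  exists `|C| => x; apply: bRintegral_norm_le => // y.
  exact: le_trans (hC y) (ler_norm _).
(* Adding [C] makes the integrand nonnegative, so that measurability of nonnegative kernel integrals
   applies; the mass term is subtracted afterwards. *)
rewrite (_ : kop K f = (fun x =>
    fine (\int[K x]_y (f y + C)%:E)%E - C * fine (K x setT))).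
  apply: measurable_funB.
    apply: measurableT_comp; first exact: fine_measurable.
    apply: measurable_fun_integral_kernel.
    - by move=> U mU; exact: measurable_kernel.
    - move=> y; rewrite lee_fin; have := hC y; rewrite ler_norml => /andP[]; lra.
    - by apply/measurable_EFinP; exact: measurable_funD.
  apply: measurable_funM => //; apply: measurableT_comp; first exact: fine_measurable.
  exact: measurable_kernel.
apply/funext => x; rewrite -[X in _ = X - _]/(\int[K x]_y (f y + C)).
by rewrite bRintegralD//; [rewrite Rintegral_cst// /kop; ring|exact: bmf_cst].
Qed.

Lemma boperator_kop : boperator (kop K).
Proof.
split; first exact: bmf_kop.
  move=> a f g bf bg; apply/funext => x.
  by rewrite /kop bRintegralD ?bRintegralZ//; exact: bmfZ.
by exists 1 => // f e bf e0 fe x; rewrite mul1r; exact: bRintegral_norm_le.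
Qed.

End bounded_functionals.

Lemma boperator_mul d (X : measurableType d) (R : realType) (h : X -> R) :
  bmf h -> boperator (fun f x => h x * f x).
Proof.
move=> bh; split.
- by move=> f bf; exact: bmfM.
- by move=> a f g _ _; apply/funext => x; ring.
- have [_ [C hC]] := bh; exists `|C| => // f e bf e0 fe x.
  by rewrite normrM ler_pM// (le_trans (hC x))// ler_norm.
Qed.

(** * Iterates of the transition operator; invariance, symmetry and positivity *)

Section kernel_iterates.
Context d (X : measurableType d) (R : realType).
Implicit Types (K L : R.-spker X ~> X) (P : R.-pker X ~> X) (p : probability X R).

Lemma Rintegral_mkcomp K L x f : bmf f ->
  \int[mkcomp_noparam K L x]_z f z = \int[K x]_y kop L f y.
Proof.
move: f; apply: (@bfunctional_ext _ X R).
- exact/bfunctional_integral/(sprob_kernel_le1 (mkcomp_noparam K L)).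
- exact/(bfunctional_comp (bfunctional_integral (sprob_kernel_le1 K x)))/boperator_kop.
- move=> B mB; rewrite Rintegral_indic// /mkcomp_noparam/=/kcomp_noparam.
  rewrite /Rintegral; congr fine; apply: eq_integral => y _.
  by rewrite /kop Rintegral_indic// fineK// mu_le1_fin_num// sprob_kernel_le1.
Qed.

Lemma bmf_iter P f n : bmf f -> bmf (iter n (kop P) f).
Proof. by move=> bf; elim: n => //= n ih; exact: bmf_kop. Qed.

(** Replaces the iterated kernel by iterates of one operator on functions, the form in which the
    estimates are made. *)
Lemma Rintegral_kpow P n x f : bmf f ->
  \int[kpow P n x]_y f y = iter n (kop P) f x.
Proof.
move=> bf; elim: n x => [|n ih] x /=.
  rewrite /kdirac /Rintegral integral_dirac//=; first by rewrite indicT mul1r.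
  by apply/measurable_EFinP; case: bf.
rewrite Rintegral_mkcomp//; apply: eq_Rintegral => y _; exact: ih.
Qed.

Lemma Rintegral_kop_invariant P p f : invariant_measure P p -> bmf f ->
  \int[p]_x kop P f x = \int[p]_x f x.
Proof.
move=> hinv; have p1 : (p setT <= 1)%E by rewrite probability_setT.
move: f; apply: (@bfunctional_ext _ X R).
- exact/(bfunctional_comp (bfunctional_integral p1))/boperator_kop.
- exact: bfunctional_integral.
- move=> B mB; transitivity (fine (p B)); last by rewrite Rintegral_indic.
  rewrite -(hinv B mB) /Rintegral; congr fine.
  apply: eq_integral => x _.
  by rewrite /kop Rintegral_indic// fineK// mu_le1_fin_num// sprob_kernel_le1.
Qed.

(** Reversibility on rectangles is the case of two indicators; [bfunctional_ext] extends it first in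
    [g], then in [f]. *)
Lemma kop_symmetric P p f g : reversible P p -> bmf f -> bmf g ->
  \int[p]_x (f x * kop P g x) = \int[p]_x (kop P f x * g x).
Proof.
move=> hrev bf bg; have p1 : (p setT <= 1)%E by rewrite probability_setT.
have Pfin x B : measurable B -> (fine (P x B))%:E = P x B.
  by move=> mB; rewrite fineK// mu_le1_fin_num// sprob_kernel_le1.
have base B1 B2 : measurable B1 -> measurable B2 ->
    \int[p]_x (\1_B1 x * kop P \1_B2 x) = \int[p]_x (kop P \1_B1 x * \1_B2 x) :> R.
  move=> m1 m2; have := hrev (B1 `*` B2) (measurableX m1 m2) => h.
  rewrite /Rintegral; congr fine; transitivity (\int[p]_x P x (xsection (B1 `*` B2) x))%E.
    apply: eq_integral => x _; rewrite indicE; case: (boolP (x \in B1)) => xB.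
      by rewrite in_xsectionX// mul1r /kop Rintegral_indic// Pfin.
    by rewrite notin_xsectionX// measure0 mul0r.
  rewrite h; apply: eq_integral => x _; rewrite indicE; case: (boolP (x \in B2)) => xB.
    by rewrite in_ysectionX// mulr1 /kop Rintegral_indic// Pfin.
  by rewrite notin_ysectionX// measure0 mulr0.
have step B1 : measurable B1 -> forall g, bmf g ->
    \int[p]_x (\1_B1 x * kop P g x) = \int[p]_x (kop P \1_B1 x * g x).
  move=> m1; apply: (@bfunctional_ext _ X R).
  - have b1 := boperator_mul (@bmf_indic _ _ R _ m1).
    exact/(bfunctional_comp (bfunctional_comp (bfunctional_integral p1) b1))/boperator_kop.
  - have b1 := boperator_mul (bmf_kop P (@bmf_indic _ _ R _ m1)).
    exact: (bfunctional_comp (bfunctional_integral p1) b1).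
  - by move=> B2 m2; exact: base.
have := @bfunctional_ext _ X R (fun f => \int[p]_x (f x * kop P g x))
   (fun f => \int[p]_x (kop P f x * g x)); apply => //.
- rewrite (_ : (fun f => _) = fun f => \int[p]_x (kop P g x * f x)).
    exact: (bfunctional_comp (bfunctional_integral p1) (boperator_mul (bmf_kop P bg))).
  by apply/funext => h; apply: eq_Rintegral => x _; rewrite mulrC.
- rewrite (_ : (fun f => _) = fun f => \int[p]_x (g x * kop P f x)).
    have hb := bfunctional_comp (bfunctional_integral p1) (boperator_mul bg).
    exact: (bfunctional_comp hb (boperator_kop P)).
  by apply/funext => h; apply: eq_Rintegral => x _; rewrite mulrC.
- by move=> B mB; exact: step.
Qed.

Lemma bmf_Lfun2 p f : bmf f -> f \in Lfun p 2%:E.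
Proof.
move=> bf; have [mf _] := bf; rewrite inE; apply/andP; split; rewrite inE//=.
rewrite /finite_norm unlock poweR_lty//; apply: integrable_lty => //.
have p1 : (p setT <= 1)%E by rewrite probability_setT.
have bn := bmf_norm bf; have := bmf_integrable p1 (bmfM bn bn).
congr (integrable _ _); apply/funext => x /=.
by rewrite powR_mulrn.
Qed.

Lemma nonneg_definite_bmf P p f : nonneg_definite P p -> bmf f ->
  0 <= \int[p]_x (f x * kop P f x).
Proof.
move=> hpos bf; have p1 : (p setT <= 1)%E by rewrite probability_setT.
rewrite -lee_fin (EFin_Rintegral p1); last exact/bmfM/bmf_kop.
have := hpos f (bmf_Lfun2 p bf); congr (_ <= _)%E; apply: eq_integral => x _.
rewrite EFinM /kop EFin_Rintegral//; exact: sprob_kernel_le1.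
Qed.

End kernel_iterates.

(** * The operator killed on the atom and the law of the hitting time *)

Definition avoid (X Omega : Type) (A : set X) (Phi : nat -> Omega -> X) n :
  set Omega := [set w | forall i, (i < n)%N -> ~ A (Phi i w)].

Lemma avoid0 (X Omega : Type) (A : set X) (Phi : nat -> Omega -> X) :
  avoid A Phi 0 = setT.
Proof. by apply/seteqP; split. Qed.

Lemma avoidS (X Omega : Type) (A : set X) (Phi : nat -> Omega -> X) n :
  avoid A Phi n.+1 = avoid A Phi n `&` Phi n @^-1` (~` A).
Proof.
apply/seteqP; split=> w /=; first by move=> h; split=> [i /ltnW|]; exact: h.
by move=> [h hn] i; rewrite ltnS leq_eqVlt => /predU1P[->//|]; exact: h.
Qed.

Section taboo.
Context d (X : measurableType d) (R : realType).
Variables (P : R.-pker X ~> X) (A : set X).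
Hypothesis mA : measurable A.

(** The operator [Q] of the overview. Since [avoid A Phi n] is the event sigma_A >= n, its iterates
    compute expectations on that event. *)
Definition taboo (f : X -> R) (x : X) : R := \1_(~` A) x * kop P f x.

Definition surv n : X -> R := iter n taboo (fun=> 1).

Lemma bmf_taboo f : bmf f -> bmf (taboo f).
Proof. by move=> bf; apply: bmfM; [exact/bmf_indic/measurableC|exact: bmf_kop]. Qed.

Lemma bmf_surv n : bmf (surv n).
Proof. by elim: n => [|n ih]; [exact: bmf_cst|exact: bmf_taboo]. Qed.

Section chain.
Context d' (Omega : measurableType d') (PP : X -> probability Omega R)
  (Phi : nat -> Omega -> X).
Hypothesis hPhi : markov_chain P PP Phi.

(** The event sigma_A > m depends on the positions up to time [m] only; [chain_step] asks this of
    its conditioning event. *)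
Lemma past_avoid m n : (m <= n)%N -> past Phi n (avoid A Phi m.+1).
Proof.
have sub Y : past Phi n Y -> Y `<=` setT by [].
have [pT _ _ pI] := (sigma_algebraP sub).1 (smallest_sigma_algebra _ _).
have step k E : (k <= n)%N -> past Phi n E -> past Phi n (E `&` Phi k @^-1` (~` A)).
  move=> kn hE; apply: pI => //; apply: sub_sigma_algebra; exists k => //.
  by exists (~` A); [exact: measurableC|rewrite setTI].
elim: m => [|m ih] mn; rewrite avoidS; apply: step => //; first by rewrite avoid0.
by apply: ih; exact: ltnW.
Qed.

Lemma measurable_avoid n : measurable (avoid A Phi n).
Proof.
elim: n => [|n ih]; first by rewrite avoid0.
rewrite avoidS; apply: measurableI => //; rewrite -[_ @^-1` _]setTI.
exact/(chain_measurable hPhi)/measurableC.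
Qed.

(** The Markov property on the event sigma_A > n; [chain_step] is the case where [g] is an
    indicator. *)
Lemma chain_step_bmf x n g : bmf g ->
  \int[PP x]_w (\1_(avoid A Phi n.+1) w * g (Phi n.+1 w)) =
  \int[PP x]_w (\1_(avoid A Phi n.+1) w * kop P g (Phi n w)).
Proof.
have p1 : (PP x setT <= 1)%E by rewrite probability_setT.
have mE := measurable_avoid n.+1; have bE := @bmf_indic _ _ R _ mE.
have mPhi k := boperator_comp R (chain_measurable hPhi k).
move: g; apply: (@bfunctional_ext _ X R).
- exact/(bfunctional_comp (bfunctional_comp (bfunctional_integral p1) (boperator_mul bE)))/mPhi.
- apply: (@bfunctional_comp _ _ X X R (fun h =>
    \int[PP x]_w (\1_(avoid A Phi n.+1) w * h (Phi n w))) _ _ (boperator_kop P)).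
  exact/(bfunctional_comp (bfunctional_comp (bfunctional_integral p1) (boperator_mul bE)))/mPhi.
move=> B mB; have := chain_step hPhi x (past_avoid (leqnn n)) mB => h.
have mPB : measurable (Phi n.+1 @^-1` B).
  by rewrite -[_ @^-1` _]setTI; apply: (chain_measurable hPhi).
transitivity (fine (PP x (avoid A Phi n.+1 `&` Phi n.+1 @^-1` B))).
  rewrite -Rintegral_indic; last exact: measurableI.
  by apply: eq_Rintegral => w _; rewrite [in RHS]indicI.
rewrite h /Rintegral [in LHS]integral_mkcond; congr fine. apply: eq_integral => w _.
rewrite patchE indicE; case: (boolP (_ \in _)) => _; last by rewrite mul0r.
by rewrite mul1r /kop Rintegral_indic// fineK// mu_le1_fin_num// sprob_kernel_le1.
Qed.

(** Induction with [g] arbitrary: the Markov property turns [g] at the last time into [kop P g] one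
    step earlier, and avoiding [A] at that earlier time turns this into [taboo g]. *)
Lemma avoid_iter_taboo x n g : bmf g ->
  \int[PP x]_w (\1_(avoid A Phi n) w * g (Phi n w)) = iter n taboo g x.
Proof.
have p1 : (PP x setT <= 1)%E by rewrite probability_setT.
elim: n g => [|n ih] g bg.
  rewrite [LHS](_ : _ = \int[PP x]_w g (Phi 0%N w)); last first.
    by apply: eq_Rintegral => w _; rewrite avoid0 indicT mul1r.
  move: g bg; apply: (@bfunctional_ext _ X R).
  - exact/(bfunctional_comp (bfunctional_integral p1))/(boperator_comp R (chain_measurable hPhi 0)).
  - split => //; exists 1 => // f e _ _ fe; by rewrite mul1r.
  - move=> B mB; rewrite -[RHS]/(\1_B x).
    transitivity (fine (PP x (Phi 0%N @^-1` B))); last by rewrite (chain_start hPhi).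
    rewrite -Rintegral_indic; first by apply: eq_Rintegral => w _.
    by rewrite -[_ @^-1` _]setTI; apply: (chain_measurable hPhi).
rewrite iterSr -(ih _ (bmf_taboo bg)) (chain_step_bmf x n bg).
by apply: eq_Rintegral => w _; rewrite avoidS indicI /taboo mulrA.
Qed.

Lemma avoid_surv x n : PP x (avoid A Phi n) = (surv n x)%:E.
Proof.
rewrite -[LHS]fineK ?fin_num_measure//; last exact: measurable_avoid.
rewrite /surv -avoid_iter_taboo; last exact: bmf_cst.
rewrite -Rintegral_indic; last exact: measurable_avoid.
by congr EFin; apply: eq_Rintegral => w _; rewrite mulr1.
Qed.

(** The sum counts the [j < n] with sigma_A >= j + 1, so it equals min(sigma_A, n). *)
Lemma sum_avoid_le_hitting n w :
  ((\sum_(j < n) \1_(avoid A Phi j.+1) w)%R%:E <= hitting_time R Phi A w)%E.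
Proof.
apply: le_ereal_inf_tmp => _ [k Ak <-]; rewrite lee_fin.
elim: n => [|n]; first by rewrite big_ord0.
rewrite big_ord_recr/=; have [kn ih|nk _] := leqP k n.
  rewrite indicE memNset ?addr0// => /(_ k).
  by rewrite ltnS => /(_ kn); apply.
apply: (@le_trans _ _ (\sum_(i < n.+1) 1)).
  by rewrite big_ord_recr/= lerD ?ler_sum// => *; rewrite indicE; case: (_ \in _).
by rewrite sumr_const card_ord ler_nat.
Qed.

Lemma measurable_hitting_time : measurable_fun setT (hitting_time R Phi A).
Proof.
have mn n : measurable (~` (Phi n @^-1` A)).
  apply: measurableC; rewrite -[_ @^-1` _]setTI.
  exact: (chain_measurable hPhi).
(* By the convention [+oo * 0 = 0], [f n] is [n] where the chain is in [A] at time [n] and [+oo]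
   elsewhere; the hitting time is the infimum of these functions. *)
pose f n w : \bar R := (n%:R%:E + +oo * (\1_(~` (Phi n @^-1` A)) w)%:E)%E.
rewrite (_ : hitting_time R Phi A = fun w => einfs (f ^~ w) 0%N).
  apply: measurable_fun_einfs => n; apply: emeasurable_funD => //.
  by apply: measurable_funeM; apply/measurable_EFinP.
apply/funext => w; apply/eqP; rewrite eq_le; apply/andP; split.
- apply: le_ereal_inf_tmp => _ [k _ <-]; rewrite /f indicE.
  case: (boolP (w \in _)) => [_|]; first by rewrite mule1 addey// leey.
  rewrite notin_setE/= => /contrapT Ak; rewrite mule0 adde0.
  by apply: ereal_inf_lbound; exists k.
- apply: le_ereal_inf_tmp => _ [k Ak <-]; apply: ge_ereal_inf.
  exists (f k w); first by exists k.
  by rewrite /f indicE memNset ?mule0 ?adde0// => /(_ Ak).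
Qed.

(** Tail-sum formula: the sum is the mean of min(sigma_A, N), hence at most the mean of sigma_A. *)
Lemma sum_surv_le (M : R) N x :
  (\int[PP x]_w hitting_time R Phi A w <= M%:E)%E ->
  \sum_(j < N) surv j.+1 x <= M.
Proof.
move=> hM; have p1 : (PP x setT <= 1)%E by rewrite probability_setT.
have bav j := @bmf_indic _ _ R _ (measurable_avoid j).
have sumE : \sum_(j < N) surv j.+1 x =
    \int[PP x]_w \sum_(j < N) \1_(avoid A Phi j.+1) w.
  elim: N => [|N ih].
    rewrite big_ord0 (_ : \int[_]_w _ = \int[PP x]_w 0).
      by rewrite Rintegral_cst// mul0r.
    by apply: eq_Rintegral => w _; rewrite big_ord0.
  rewrite big_ord_recr/= ih.
  have bsum := @bmf_sum _ _ R N (fun j => \1_(avoid A Phi j.+1)) (fun j _ => bav _).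
  have := bRintegralD p1 bsum (bav N.+1).
  rewrite [X in _ + X](_ : _ = surv N.+1 x) => [<-|].
    by apply: eq_Rintegral => w _; rewrite big_ord_recr.
  rewrite Rintegral_indic; last exact: measurable_avoid.
  exact: (congr1 fine (avoid_surv x N.+1)).
have bs : bmf (fun w => \sum_(j < N) (\1_(avoid A Phi j.+1) w : R)).
  by apply: (@bmf_sum _ _ R N (fun j => \1_(avoid A Phi j.+1))) => j _.
rewrite -lee_fin sumE (EFin_Rintegral p1)//; apply: le_trans hM.
apply: ge0_le_integral => //.
- by move=> w _; rewrite lee_fin sumr_ge0.
- by apply/measurable_EFinP; case: bs.
- exact: measurable_hitting_time.
- by move=> w _; exact: sum_avoid_le_hitting.
Qed.

End chain.
End taboo.

Arguments surv : simpl never.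

(** * Truncated moments of the hitting time and its geometric tail *)

Section survival.
Context d (X : measurableType d) (R : realType).
Variables (P : R.-pker X ~> X) (A : set X).
Hypothesis mA : measurable A.
Local Notation taboo := (taboo P A).
Local Notation surv := (surv P A).

Let P1 x : (P x setT <= 1)%E := sprob_kernel_le1 P x.

Lemma kop_cst (a : R) x : kop P (fun=> a) x = a.
Proof. by rewrite /kop Rintegral_cst// prob_kernel mulr1. Qed.

Lemma le_kop (f g : X -> R) x : bmf f -> bmf g -> (forall y, f y <= g y) ->
  kop P f x <= kop P g x.
Proof. by move=> bf bg fg; exact: bRintegral_le. Qed.

Lemma le_taboo (f g : X -> R) x : bmf f -> bmf g -> (forall y, f y <= g y) ->
  taboo f x <= taboo g x.
Proof. by move=> bf bg fg; rewrite /taboo ler_wpM2l// le_kop. Qed.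

Lemma tabooZ (a : R) (f : X -> R) x : bmf f ->
  taboo (fun y => a * f y) x = a * taboo f x.
Proof. by move=> bf; rewrite /taboo /kop bRintegralZ// mulrCA. Qed.

Lemma tabooD (f g : X -> R) x : bmf f -> bmf g ->
  taboo (fun y => f y + g y) x = taboo f x + taboo g x.
Proof. by move=> bf bg; rewrite /taboo /kop bRintegralD// mulrDr. Qed.

Lemma taboo_in (f : X -> R) x : A x -> taboo f x = 0.
Proof. by move=> Ax; rewrite /taboo indicE memNset ?mul0r. Qed.

Lemma taboo_notin (f : X -> R) x : ~ A x -> taboo f x = kop P f x.
Proof. by move=> Ax; rewrite /taboo indicE mem_set ?mul1r. Qed.

Lemma surv1 x : surv 1 x = \1_(~` A) x.
Proof. by rewrite /surv/= /taboo kop_cst mulr1. Qed.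

Lemma surv_ge0 n x : 0 <= surv n x.
Proof.
case: n => [|n]; first by rewrite /surv/=.
elim: n x => [|n ih] x; first by rewrite surv1.
by apply: mulr_ge0 => //; apply: Rintegral_ge0 => y _; exact: ih.
Qed.

Lemma surv_antitone n x : surv n.+1 x <= surv n x.
Proof.
elim: n x => [|n ih] x.
  by rewrite surv1 /surv/= indicE; case: (_ \in _).
by apply: (@le_taboo (surv n.+1) (surv n)) => //; exact: bmf_surv.
Qed.

Lemma surv_in n x : A x -> surv n.+1 x = 0.
Proof. exact: taboo_in. Qed.

Lemma bmf_sum_surv (a : nat -> R) N : bmf (fun x => \sum_(j < N) a j * surv j.+1 x).
Proof.
by apply: (@bmf_sum _ _ R N (fun j x => a j * surv j.+1 x)) => j _; exact/bmfZ/bmf_surv.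
Qed.

Lemma taboo_sum_surv (a : nat -> R) N x :
  taboo (fun y => \sum_(j < N) a j * surv j.+1 y) x = \sum_(j < N) a j * surv j.+2 x.
Proof.
elim: N => [|N ih].
  rewrite big_ord0 (_ : (fun y => _) = fun y => 0 * (1 : R)).
    by rewrite tabooZ ?mul0r//; exact: bmf_cst.
  by apply/funext => y; rewrite big_ord0 mul0r.
have bN := bmf_surv P mA N.+1; rewrite big_ord_recr/= -ih.
rewrite -[surv N.+2 x]/(taboo (surv N.+1) x) -tabooZ//.
rewrite -tabooD; [|exact: bmf_sum_surv|exact: bmfZ].
by congr taboo; apply/funext => y; rewrite big_ord_recr.
Qed.

(* the expectation of min(sigma_A, N) *)
Definition psum N x : R := \sum_(j < N) surv j.+1 x.

Lemma bmf_psum N : bmf (psum N).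
Proof.
have := bmf_sum_surv (fun=> 1) N; congr bmf; apply/funext => x.
by apply: eq_bigr => j _; rewrite mul1r.
Qed.

(** The drift identity: off [A], up to the tail term [surv N.+1 x], one step lowers the truncated
    mean by 1. *)
Lemma taboo_psum N x : taboo (psum N) x = psum N.+1 x - surv 1 x.
Proof.
rewrite /psum big_ord_recl/= addrC addKr.
have := taboo_sum_surv (fun=> 1) N x; under [RHS]eq_bigr do rewrite mul1r.
by move=> <-; congr taboo; apply/funext => y; apply: eq_bigr => j _; rewrite mul1r.
Qed.

Variable M : R.
Hypothesis hM : forall N x, psum N x <= M.
Variable lam : R.
Hypothesis lam1 : 1 < lam.

(* [1 + gen N x] is the expectation of lam ^ min(sigma_A, N) *)
Definition gen N x : R := \sum_(j < N) ((lam - 1) * lam ^+ j) * surv j.+1 x.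

Lemma lam_taboo_gen N x : lam * taboo (gen N) x = gen N.+1 x - (lam - 1) * surv 1 x.
Proof.
rewrite /gen (taboo_sum_surv (fun j => (lam - 1) * lam ^+ j)) big_ord_recl/=.
rewrite expr0 mulr1 [RHS]addrAC subrr add0r mulr_sumr.
by apply: eq_bigr => j _; rewrite /bump/= add1n exprS; ring.
Qed.

(* The Markov property applied to lam ^ s = 1 + sum_(j < s) (1 - 1/lam) lam ^ (s - j). *)
Lemma gen_step N x :
  gen N.+1 x = (1 - lam^-1) * surv 1 x * (1 + gen N.+1 x) + taboo (gen N) x.
Proof.
have l0 : lam != 0 by rewrite gt_eqF// (lt_trans ltr01).
have := lam_taboo_gen N x; have [Ax|nAx] := pselect (A x).
  by rewrite surv_in// taboo_in// !mulr0 subr0 mul0r addr0 => <-.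
have -> : surv 1 x = 1 by rewrite surv1 indicE mem_set.
move=> h; have -> : taboo (gen N) x = lam^-1 * (gen N.+1 x - (lam - 1) * 1).
  by rewrite -h mulKf.
by field.
Qed.

Lemma le_gen m n x : (m <= n)%N -> gen m x <= gen n x.
Proof.
move=> /subnK <-; elim: (n - m)%N => [//|k ih]; rewrite addSn.
apply: (le_trans ih); rewrite [leRHS]/gen big_ord_recr/= lerDl.
have l0 : 0 <= lam by rewrite (le_trans ler01)// ltW.
by rewrite mulr_ge0 ?surv_ge0// mulr_ge0 ?exprn_ge0// subr_ge0 ltW.
Qed.

(** By [gen_step], [gen] obeys a recursion whose source is at most [(1 - lam^-1) * U] times
    [surv 1]; [psum] obeys the same recursion with source [surv 1], and [taboo] is monotone. *)
Lemma gen_le_sum_surv U N : (forall x, 1 + gen N x <= U) ->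
  forall k x, (k <= N)%N -> gen k x <= (1 - lam^-1) * U * psum k x.
Proof.
move=> hU; have l0 : 0 < lam by rewrite (lt_trans ltr01).
have c0 : 0 <= 1 - lam^-1 by rewrite subr_ge0 invf_le1// ltW.
elim=> [|k ih] x kN; first by rewrite /gen /psum !big_ord0 mulr0.
have -> : psum k.+1 x = surv 1 x + taboo (psum k) x.
  by rewrite taboo_psum addrC subrK.
rewrite gen_step [leRHS]mulrDr lerD//.
  move: (surv 1 x) (surv_ge0 1 x) => s s0.
  rewrite -!mulrA ler_wpM2l// mulrC ler_wpM2r//.
  by rewrite (le_trans _ (hU x))// lerD2l le_gen.
rewrite -tabooZ; last exact: bmf_psum.
apply: le_taboo; [exact: (bmf_sum_surv (fun j => (lam - 1) * lam ^+ j))|exact/bmfZ/bmf_psum|].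
by move=> y; apply: ih; exact: ltnW.
Qed.

(** Markov's inequality for lam ^ min(sigma_A, N) on the event sigma_A >= N. *)
Lemma expn_surv_le_gen N x : lam ^+ N * surv N x <= 1 + gen N x.
Proof.
elim: N => [|N ih]; first by rewrite /gen big_ord0 expr0 mul1r addr0.
rewrite [gen _ _]big_ord_recr/= addrA exprS.
have -> : lam * lam ^+ N * surv N.+1 x =
    lam ^+ N * surv N.+1 x + (lam - 1) * lam ^+ N * surv N.+1 x by ring.
rewrite lerD2r; apply: le_trans ih; rewrite ler_wpM2l ?surv_antitone//.
by rewrite exprn_ge0// (le_trans ler01)// ltW.
Qed.

Hypothesis lamM : M * ln lam < 1.

(** The supremum [U] of [1 + gen n] satisfies [U <= 1 + (1 - lam^-1) * M * U]; as
    [1 - lam^-1 <= ln lam], this solves to [U <= (1 - M * ln lam)^-1]. *)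
Lemma surv_geometric n x : surv n x <= (1 - M * ln lam)^-1 * lam ^- n.
Proof.
have l0 : 0 < lam by rewrite (lt_trans ltr01).
have c0 : 0 <= 1 - lam^-1 by rewrite subr_ge0 invf_le1// ltW.
have M0 : 0 <= M by have := hM 0 x; rewrite /psum big_ord0.
have cln : 1 - lam^-1 <= ln lam.
  have := expR_ge1Dx (- ln lam); rewrite expRN lnK ?posrE//; lra.
have cM : (1 - lam^-1) * M <= M * ln lam by rewrite mulrC ler_wpM2l.
rewrite ler_pdivlMr ?exprn_gt0// mulrC.
apply: (le_trans (expn_surv_le_gen n x)).
have [_ [C hC]] : bmf (gen n) by exact: (bmf_sum_surv (fun j => (lam - 1) * lam ^+ j)).
(* The truncation makes [gen n] bounded, so [U] is a genuine supremum and can be absorbed into the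
   left-hand side. *)
pose U := sup (range (fun y => 1 + gen n y)).
have Uub : has_sup (range (fun y => 1 + gen n y)).
  split; first by exists (1 + gen n x); exists x.
  by exists (1 + C) => _ [y _ <-]; rewrite lerD2l (le_trans _ (hC y))// ler_norm.
have hU y : 1 + gen n y <= U by apply: ub_le_sup; [exact: Uub.2|exists y].
have U0 : 0 <= U.
  rewrite (le_trans _ (hU x))// addr_ge0//.
  have := @le_gen 0 n x (leq0n _); by rewrite {1}/gen big_ord0.
have hU' : U <= 1 + (1 - lam^-1) * M * U.
  apply: ge_sup; first exact: Uub.1.
  move=> _ [y _ <-]; rewrite lerD2l.
  apply: (le_trans (gen_le_sum_surv hU y (leqnn n))).
  by rewrite mulrAC ler_wpM2r// ler_wpM2l.
apply: (le_trans (hU x)); rewrite -[leRHS]mul1r ler_pdivlMr ?subr_gt0//.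
have : (1 - lam^-1) * M * U <= M * ln lam * U by rewrite ler_wpM2r.
lra.
Qed.

End survival.

(** * The inner product of L^2(p) *)

Section inner_product.
Context d (X : measurableType d) (R : realType) (p : probability X R).
Implicit Types f g h : X -> R.

Definition ip f g : R := \int[p]_x (f x * g x).

Let p1 : (p setT <= 1)%E. Proof. by rewrite probability_setT. Qed.

Lemma ipC f g : ip f g = ip g f.
Proof. by apply: eq_Rintegral => x _; rewrite mulrC. Qed.

Lemma ipDl a f b g h : bmf f -> bmf g -> bmf h ->
  ip (fun x => a * f x + b * g x) h = a * ip f h + b * ip g h.
Proof.
move=> bf bg bh; have bfh := bmfM bf bh; have bgh := bmfM bg bh.
rewrite /ip -!(bRintegralZ p1)// -(bRintegralD p1); try exact: bmfZ.
by apply: eq_Rintegral => x _; ring.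
Qed.

Lemma ipDr a f b g h : bmf f -> bmf g -> bmf h ->
  ip h (fun x => a * f x + b * g x) = a * ip h f + b * ip h g.
Proof. by move=> bf bg bh; rewrite ipC ipDl// !(ipC h). Qed.

Lemma ip_ge0 f : 0 <= ip f f.
Proof. by apply: Rintegral_ge0 => x _; rewrite -expr2 sqr_ge0. Qed.

Lemma ip1 f : ip (fun=> 1) f = \int[p]_x f x.
Proof. by apply: eq_Rintegral => x _; rewrite mul1r. Qed.

Lemma ip11 : ip (fun=> 1) (fun=> 1) = 1.
Proof.
rewrite ip1; transitivity (1 * fine (p setT)); first exact: Rintegral_cst.
by rewrite probability_setT mulr1.
Qed.

(** The variance of the product [f g] under [p] is nonnegative, and its second moment is at most
    that of [f]. *)
Lemma ip_sqr_le f g : bmf f -> bmf g -> (forall x, `|g x| <= 1) ->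
  ip f g ^+ 2 <= ip f f.
Proof.
move=> bf bg g1; set m := ip f g.
have bfg := bmfM bf bg; have b1 := @bmf_cst _ X R 1.
have h1 := ip_ge0 (fun x => 1 * (f x * g x) + (- m) * 1).
have b2 : bmf (fun x => 1 * (f x * g x) + (- m) * 1).
  by apply: bmfD; exact: bmfZ.
rewrite ipDl// !ipDr// ip11 ip1 (ipC _ (fun=> 1)) ip1 -[Rintegral _ _ _]/m in h1.
have h2 : ip (fun x => f x * g x) (fun x => f x * g x) <= ip f f.
  apply: (bRintegral_le p1); [exact: bmfM|exact: bmfM|move=> x].
  have -> : f x * g x * (f x * g x) = f x * f x * `|g x| ^+ 2.
    by rewrite real_normK ?num_real//; ring.
  by rewrite ler_piMr// -?expr2 ?sqr_ge0// expr_le1.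
by rewrite expr2; lra.
Qed.

End inner_product.

Lemma bmf_inv d (X : measurableType d) (R : realType) (f : X -> R) :
  bmf f -> (forall x, 1 <= f x) -> bmf (fun x => (f x)^-1).
Proof.
move=> [mf _] f1; have f0 x : 0 < f x := lt_le_trans ltr01 (f1 x).
split; last first.
  exists 1 => x; have h : 0 <= (f x)^-1 by rewrite invr_ge0 (ltW (f0 x)).
  by rewrite (ger0_norm h) invf_le1.
(* Measurability of the reciprocal is inherited from that of exp and ln. *)
rewrite (_ : (fun x => _) = (fun x => expR (- ln (f x)))).
  apply: measurableT_comp; first exact: measurable_expR.
  by apply: measurableT_comp => //; apply: measurableT_comp => //; exact: measurable_ln.
by apply/funext => x; rewrite expRN lnK// posrE.
Qed.

(** * Contraction in L^2(p) and convergence from the atom *)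

Section contraction.
Context d (X : measurableType d) (R : realType).
Variables (P : R.-pker X ~> X) (p : probability X R) (A : set X).
Hypothesis mA : measurable A.
Hypothesis hinv : invariant_measure P p.
Hypothesis hrev : reversible P p.
Hypothesis hpos : nonneg_definite P p.
Local Notation ip := (ip p).
Local Notation surv := (surv P A).
Local Notation psum := (psum P A).

Let p1 : (p setT <= 1)%E. Proof. by rewrite probability_setT. Qed.
Let P1 x : (P x setT <= 1)%E := sprob_kernel_le1 P x.

Lemma ip_kop f g : bmf f -> bmf g -> ip f (kop P g) = ip (kop P f) g.
Proof. exact: kop_symmetric. Qed.

Variable M : R.
Hypothesis M0 : 0 < M.
Hypothesis hM : forall N x, psum N x <= M.

(** The form bound with the truncation error [e] still present: off [A] the truncated mean [w]
    satisfies [P w <= w - (1 - e)], and dividing by [w <= M] gives the factor. *)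
Lemma killed_form_le_approx e N (g : X -> R) : e <= 1 ->
  (forall x, surv N.+2 x <= e) -> bmf g -> (forall x, A x -> g x = 0) ->
  ip g (kop P g) <= (1 - (1 - e) / M) * ip g g.
Proof.
(* [v] equals [w] off [A] and 1 on [A], where [w] vanishes, so that its reciprocal is bounded. *)
move=> e1 hs bg gA; pose w := psum N.+1; pose v x := w x + \1_A x.
have bw : bmf w by exact: bmf_psum.
have w0 x : A x -> w x = 0.
  by move=> Ax; rewrite /w /psum big1// => j _; exact: surv_in.
have w1 x : ~ A x -> 1 <= w x.
  move=> nAx; rewrite /w /psum big_ord_recl/= surv1 indicE mem_set// lerDl.
  by apply: sumr_ge0 => j _; exact: surv_ge0.
have v1 x : 1 <= v x.
  rewrite /v indicE; have [Ax|nAx] := pselect (A x); first by rewrite w0// mem_set ?add0r.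
  by rewrite memNset// addr0 w1.
have vE x : ~ A x -> v x = w x by move=> nAx; rewrite /v indicE memNset// addr0.
have bv : bmf v by apply: bmfD => //; exact: bmf_indic.
pose a x := g x * g x * (v x)^-1.
have ba : bmf a by apply: bmfM; [exact: bmfM|exact: bmf_inv].
(* AM-GM with the weights w(y)/w(x): w is superharmonic off A *)
have amgm x y : g x * g y <= 2^-1 * a x * w y + 2^-1 * w x * a y.
  have [Ax|nAx] := pselect (A x); first by rewrite /a (gA x)// (w0 x)// !(mul0r,mulr0) addr0.
  have [Ay|nAy] := pselect (A y); first by rewrite /a (gA y)// (w0 y)// !(mul0r,mulr0) addr0.
  rewrite /a !vE//; have wx := lt_le_trans ltr01 (w1 _ nAx).
  have wy := lt_le_trans ltr01 (w1 _ nAy).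
  rewrite -subr_ge0 (_ : _ - _ = (g x * w y - g y * w x) ^+ 2 / (2 * w x * w y)).
    by rewrite divr_ge0 ?sqr_ge0// !mulr_ge0// ltW.
  by field; rewrite !gt_eqF.
have step1 x : g x * kop P g x <= 2^-1 * a x * kop P w x + 2^-1 * w x * kop P a x.
  rewrite /kop -!(bRintegralZ (P1 x))// -(bRintegralD (P1 x)); try exact: bmfZ.
  by apply: (bRintegral_le (P1 x)) => //; [exact: bmfZ|apply: bmfD; exact: bmfZ].
have bPw := bmf_kop P bw; have bPa := bmf_kop P ba.
(* Once integrated, the two halves of the AM-GM bound coincide, because [P] is symmetric. *)
have step2 : ip g (kop P g) <= ip a (kop P w).
  apply: (@le_trans _ _ (2^-1 * ip a (kop P w) + 2^-1 * ip w (kop P a))).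
    rewrite /ip -!(bRintegralZ p1) ?(bmfM _ _)//; try exact: bmfM.
    rewrite -(bRintegralD p1); try exact/bmfZ/bmfM.
    apply: (bRintegral_le p1).
    - by apply: bmfM => //; exact: bmf_kop.
    - by apply: bmfD; exact/bmfZ/bmfM.
    - by move=> x; have := step1 x; rewrite -!mulrA.
  by rewrite (ip_kop bw ba) (ipC _ (kop P w)); lra.
apply: (le_trans step2); rewrite /ip -(bRintegralZ p1); last exact: bmfM.
apply: (bRintegral_le p1); [exact: bmfM|exact/bmfZ/bmfM|move=> x].
have [Ax|nAx] := pselect (A x); first by rewrite /a gA// !(mul0r,mulr0).
have Pw : kop P w x <= w x - (1 - e).
  rewrite -(taboo_notin P w nAx) taboo_psum//.
  have -> : psum N.+2 x = w x + surv N.+2 x by rewrite /psum big_ord_recr.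
  by have := hs x; rewrite surv1 indicE mem_set//=; lra.
have wx := lt_le_trans ltr01 (w1 _ nAx); have wM : w x <= M := hM _ _.
have G0 : 0 <= g x * g x by rewrite -expr2 sqr_ge0.
rewrite /a vE// [leRHS]mulrC -mulrA ler_wpM2l// mulrC ler_pdivrMr//.
apply: (le_trans Pw); rewrite mulrBl mul1r lerB// -[leRHS]mulr1.
by rewrite -mulrA ler_wpM2l ?subr_ge0// mulrC ler_pdivrMr// mul1r.
Qed.
Hypothesis small : forall e, 0 < e -> exists N, forall x, surv N x <= e.

Lemma killed_form_le (g : X -> R) : bmf g -> (forall x, A x -> g x = 0) ->
  ip g (kop P g) <= (1 - M^-1) * ip g g.
Proof.
move=> bg gA; apply/ler_addgt0Pr => e e0.
pose c := ip g g / M; have c0 : 0 <= c by rewrite divr_ge0 ?ip_ge0// ltW.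
have c1 : 0 < c + 1 by rewrite ltr_wpDl.
(* Makes the error [e' * c] at most [e] while respecting the condition [e' <= 1]. *)
pose e' := Num.min 1 (e / (c + 1)).
have e'0 : 0 < e' by rewrite lt_min ltr01 divr_gt0.
have [N hN] := small e'0.
have hN2 x : surv N.+2 x <= e'.
  by rewrite (le_trans (surv_antitone _ _ _ _))// (le_trans (surv_antitone _ _ _ _)).
have e'1 : e' <= 1 by rewrite ge_min lexx.
apply: (le_trans (killed_form_le_approx e'1 hN2 bg gA)).
have -> : (1 - (1 - e') / M) * ip g g = (1 - M^-1) * ip g g + e' * c by rewrite /c; ring.
rewrite lerD2l; have : e' <= e / (c + 1) by rewrite ge_min lexx orbT.
rewrite ler_pdivlMr// mulrDr mulr1; lra.
Qed.

Lemma ip1_kop f : bmf f -> ip (fun=> 1) (kop P f) = ip (fun=> 1) f.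
Proof. by move=> bf; rewrite !ip1 Rintegral_kop_invariant. Qed.

(* Subtracting the value of f on A does not change the Dirichlet form and only
   increases the norm of a centred f. *)
Lemma form_le (c : R) (f : X -> R) : bmf f -> (forall x, A x -> f x = c) ->
  \int[p]_x f x = 0 -> ip f (kop P f) <= (1 - M^-1) * ip f f.
Proof.
move=> bf fc f0; have b1 := @bmf_cst _ X R 1.
pose g x := 1 * f x + (- c) * 1.
have bg : bmf g by apply: bmfD; exact: bmfZ.
have gA x : A x -> g x = 0 by move=> Ax; rewrite /g fc//; ring.
have Pg : kop P g = fun x => 1 * kop P f x + (- c) * 1.
  apply/funext => x; rewrite /kop (bRintegralD (P1 x)) ?(bRintegralZ (P1 x))//; try exact: bmfZ.
  by rewrite -[X in _ + _ * X]/(kop P (fun=> 1) x) kop_cst.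
have bPf := bmf_kop P bf.
have f1 : ip (fun=> 1) f = 0 by rewrite ip1.
have := killed_form_le bg gA; rewrite Pg /g !(ipDl, ipDr)//; try by apply: bmfD; exact: bmfZ.
rewrite (ipC _ f (fun=> 1)) ip1_kop// f1 ip11 => h.
have M0' : 0 <= M^-1 by rewrite invr_ge0 ltW.
have : 0 <= M^-1 * (c * c) by rewrite mulr_ge0// -expr2 sqr_ge0.
lra.
Qed.

Variable rho : R.
Hypothesis rho0 : 0 < rho.
Hypothesis rhoM : 1 - M^-1 <= rho.

Hypothesis atomA : exists nu : probability X R,
  forall x, A x -> forall B, measurable B -> P x B = nu B.

Lemma kop_atom f : bmf f -> exists c, forall x, A x -> kop P f x = c.
Proof.
have [nu hnu] := atomA; move=> bf; exists (\int[nu]_x f x) => x Ax.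
by rewrite /kop /Rintegral; congr fine; apply: eq_measure_integral => B mB _; exact: hnu.
Qed.

(* Positivity of [P f - rho f, P (P f - rho f)] turns the bound on the form
   into a bound on the norm. *)
Lemma norm_kop_le f : bmf f -> (exists c, forall x, A x -> f x = c) ->
  \int[p]_x f x = 0 -> ip (kop P f) (kop P f) <= rho ^+ 2 * ip f f.
Proof.
move=> bf [c fc] f0; have bPf := bmf_kop P bf; have bPPf := bmf_kop P bPf.
have [c' Pfc] := kop_atom bf.
have Pf0 : \int[p]_x kop P f x = 0 by rewrite Rintegral_kop_invariant.
have h1 : ip f (kop P f) <= rho * ip f f.
  by rewrite (le_trans (form_le bf fc f0))// ler_wpM2r ?ip_ge0.
have h2 : ip (kop P f) (kop P (kop P f)) <= rho * ip (kop P f) (kop P f).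
  by rewrite (le_trans (form_le bPf Pfc Pf0))// ler_wpM2r ?ip_ge0.
pose h x := 1 * kop P f x + (- rho) * f x.
have bh : bmf h by apply: bmfD; exact: bmfZ.
have Ph : kop P h = fun x => 1 * kop P (kop P f) x + (- rho) * kop P f x.
  by apply/funext => x; rewrite /kop (bRintegralD (P1 x)) ?(bRintegralZ (P1 x))//; exact: bmfZ.
have := nonneg_definite_bmf hpos bh; rewrite -/(ip h (kop P h)) Ph /h.
rewrite !(ipDl, ipDr)//; try by apply: bmfD; exact: bmfZ.
rewrite (ip_kop bf bPf) => h3.
have h4 : rho ^+ 2 * ip f (kop P f) <= rho ^+ 2 * (rho * ip f f).
  by rewrite ler_wpM2l// sqr_ge0.
(* [h3] reads 0 <= <Pf, PPf> - 2 rho |Pf|^2 + rho^2 <f, Pf>; by [h2] and [h4] this gives rho |Pf|^2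
   <= rho^3 |f|^2. *)
rewrite -(ler_pM2l rho0); nra.
Qed.

Hypothesis pA : (0 < p A)%E.

Let a := fine (p A).

Let a0 : 0 < a.
Proof. by rewrite -lte_fin fineK// fin_num_measure. Qed.

Let phi x : R := a^-1 * \1_A x + (-1) * 1.

Let bA : bmf (\1_A : X -> R). Proof. exact: bmf_indic. Qed.

Let bphi : bmf phi.
Proof. by apply: bmfD; [exact: bmfZ|exact/bmfZ/bmf_cst]. Qed.

Let int_A : ip (fun=> 1) \1_A = a.
Proof. by rewrite ip1; exact: Rintegral_indic. Qed.

Let phi0 : \int[p]_x phi x = 0.
Proof.
have b1 := @bmf_cst _ X R 1.
by rewrite -ip1 ipDr// int_A ip11 mulVf ?gt_eqF//; ring.
Qed.

Let norm_phi : ip phi phi = a^-1 - 1.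
Proof.
have b1 := @bmf_cst _ X R 1.
have AA : ip \1_A \1_A = a.
  rewrite -int_A; apply: eq_Rintegral => x _.
  by rewrite indicE; case: (_ \in _); rewrite ?mulr1 ?mulr0.
rewrite [LHS]ipDl// !ipDr// (ipC _ \1_A (fun=> 1)) int_A AA ip11.
by field; rewrite gt_eqF.
Qed.

Lemma norm_iter_phi n : ip (iter n (kop P) phi) (iter n (kop P) phi) <=
  rho ^+ n ^+ 2 * (a^-1 - 1).
Proof.
(* The induction also carries the two conditions of [norm_kop_le]: iterates stay centred and
   constant on [A]. *)
have [//] : ip (iter n (kop P) phi) (iter n (kop P) phi) <= rho ^+ n ^+ 2 * (a^-1 - 1) /\
   \int[p]_x iter n (kop P) phi x = 0 /\
  exists c, forall x, A x -> iter n (kop P) phi x = c.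
elim: n => [|n [ih1 [ih2 ih3]]].
  rewrite /= expr0 expr1n mul1r norm_phi; split => //; split => //.
  by exists (a^-1 * 1 + (-1) * 1) => x Ax; rewrite /phi indicE mem_set.
have bn := bmf_iter P n bphi.
split; last by split; [rewrite /= Rintegral_kop_invariant|exact: kop_atom].
apply: (le_trans (norm_kop_le bn ih3 ih2)).
by rewrite [rho ^+ n.+1]exprS exprMn -[leRHS]mulrA ler_wpM2l// sqr_ge0.
Qed.

Lemma ip_iter n f g : bmf f -> bmf g ->
  ip f (iter n (kop P) g) = ip (iter n (kop P) f) g.
Proof.
elim: n f => [//|n ih] f bf bg; rewrite iterS iterSr.
by rewrite ip_kop//; [rewrite ih//; exact: bmf_kop|exact: bmf_iter].
Qed.

(** After at least one step the iterate is constant on [A], so its value at [x] is its mean over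
    [A]. The difference is therefore its inner product with [phi]; symmetry moves the iterates onto
    [phi], and [ip_sqr_le] applies. *)
Lemma atom_convergence n f x : bmf f -> (forall y, `|f y| <= 1) -> A x ->
  `|iter n.+1 (kop P) f x - \int[p]_y f y| <= Num.sqrt (a^-1 - 1) * rho ^+ n.+1.
Proof.
move=> bf f1 Ax; set F := iter n.+1 (kop P) f.
have bF : bmf F by exact: bmf_iter.
have [c hc] := kop_atom (bmf_iter P n bf).
have b1 := @bmf_cst _ X R 1.
have -> : F x - \int[p]_y f y = ip (iter n.+1 (kop P) phi) f.
  rewrite -ip_iter// -/F ipDl// (_ : ip \1_A F = c * a).
    rewrite ip1 mulrCA mulVf ?gt_eqF// mulr1 mulN1r [F x]hc//; congr (_ - _).
    rewrite /F; elim: n {F bF hc} => [|n ih]; first by rewrite Rintegral_kop_invariant.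
    by rewrite iterS Rintegral_kop_invariant//; exact: bmf_iter.
  rewrite -int_A ip1 -(bRintegralZ p1)//; apply: eq_Rintegral => y _.
  rewrite indicE; case: (boolP (y \in A)); last by rewrite mul0r mulr0.
  by rewrite inE mul1r mulr1 => Ay; exact: hc.
have a1 : 0 <= a^-1 - 1 by rewrite -norm_phi ip_ge0.
rewrite -(ler_sqr (normr_ge0 _)) ?nnegrE ?mulr_ge0 ?sqrtr_ge0 ?exprn_ge0 ?(ltW rho0)//.
rewrite real_normK ?num_real// exprMn sqr_sqrtr// mulrC.
apply: (le_trans _ (norm_iter_phi _)); apply: ip_sqr_le => //; exact: bmf_iter.
Qed.

End contraction.

Lemma geometric_small (R : realType) (mu B e : R) : 0 <= mu < 1 -> 0 <= B -> 0 < e ->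
  exists n, B * mu ^+ n <= e.
Proof.
move=> /andP[mu0 mu1] B0 e0.
have /cvgrPdist_lt /(_ (e / (B + 1))) : (fun n => mu ^+ n) @ \oo --> 0.
  by apply: cvg_expr; rewrite ger0_norm.
have B1 : 0 < B + 1 by rewrite ltr_wpDl.
move=> /(_ (divr_gt0 e0 B1)) [n _ /(_ n (leqnn n))] /=.
rewrite sub0r normrN ger0_norm ?exprn_ge0// ltr_pdivlMr// => h.
exists n; have : 0 <= mu ^+ n by rewrite exprn_ge0.
by rewrite mulrDr mulr1 in h; lra.
Qed.

Lemma kop_sub_cst d (X : measurableType d) (R : realType) (P : R.-pker X ~> X)
  (f : X -> R) (c : R) x : bmf f -> kop P (fun y => f y - c) x = kop P f x - c.
Proof.
move=> bf; rewrite -[in RHS](kop_cst P c x) /kop bRintegralB//.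
- exact: sprob_kernel_le1.
- exact: bmf_cst.
Qed.

(** * Convergence from an arbitrary point by first entrance *)

Section hitting_convergence.
Context d (X : measurableType d) (R : realType).
Variables (P : R.-pker X ~> X) (p : probability X R) (A : set X).
Hypothesis mA : measurable A.
Local Notation surv := (surv P A).
Local Notation taboo := (taboo P A).

Variables (rho C : R).
Hypothesis rho01 : 0 < rho < 1.

(* the expectation of rho ^ (n - sigma_A)^+ *)
Fixpoint discount n x : R :=
  if n is m.+1 then rho * discount m x + (1 - rho) * surv m.+1 x else 1.

Lemma bmf_discount n : bmf (discount n).
Proof.
elim: n => [|n ih]; first exact: bmf_cst.
by apply: bmfD; apply: bmfZ => //; exact: bmf_surv.
Qed.

(** Off [A], one step lowers both [n] and sigma_A by 1 and leaves the exponent unchanged; on [A] the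
    left side vanishes and [discount n.+1 x] is [rho ^+ n.+1]. *)
Lemma taboo_discount n x :
  taboo (discount n) x = discount n.+1 x - rho ^+ n.+1 * (1 - surv 1 x).
Proof.
elim: n => [|n ih]; first by rewrite -[LHS]/(surv 1 x) /= expr1; ring.
have bs := bmf_surv P mA n.+1; have bd := bmf_discount n.
have -> : discount n.+2 x = rho * discount n.+1 x + (1 - rho) * surv n.+2 x by [].
rewrite [LHS](@tabooD _ _ _ _ _ (fun y => rho * discount n y)
  (fun y => (1 - rho) * surv n.+1 y)); [|exact: bmfZ|exact: bmfZ].
rewrite !tabooZ// ih -[taboo (surv n.+1) x]/(surv n.+2 x) [rho ^+ n.+2]exprS; ring.
Qed.

(** If sigma_A < n the error is C rho^(n - sigma_A), by the bound on the atom; if sigma_A >= n only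
    the trivial bound 2 is used. As [discount] already contributes [C] in the second case, [2 - C]
    remains there. *)
Lemma dist_le_discount (f : X -> R) : bmf f -> (forall y, `|f y| <= 1) ->
  (forall n x, A x -> `|iter n.+1 (kop P) f x - \int[p]_y f y| <= C * rho ^+ n.+1) ->
  forall n x, `|iter n (kop P) f x - \int[p]_y f y| <=
    (2 - C) * surv n x + C * discount n x.
Proof.
move=> bf f1 hA; have p1 : (p setT <= 1)%E by rewrite probability_setT.
elim=> [|n ih] x.
  rewrite /= -[surv 0 x]/1 mulr1 mulr1 subrK (le_trans (ler_normB _ _))//.
  have : `|\int[p]_y f y| <= 1 by exact: bRintegral_norm_le.
  by have := f1 x; lra.
pose b y := (2 - C) * surv n y + C * discount n y.
have bb : bmf b by apply: bmfD; apply: bmfZ; [exact: bmf_surv|exact: bmf_discount].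
have tb : taboo b x = (2 - C) * surv n.+1 x +
    C * (discount n.+1 x - rho ^+ n.+1 * (1 - surv 1 x)).
  have bs := bmf_surv P mA n; have bd := bmf_discount n.
  by rewrite /b tabooD; [rewrite !tabooZ// taboo_discount|exact: bmfZ|exact: bmfZ].
have -> : (2 - C) * surv n.+1 x + C * discount n.+1 x =
    taboo b x + C * rho ^+ n.+1 * (1 - surv 1 x) by rewrite tb; ring.
rewrite surv1 indicE; have [Ax|nAx] := pselect (A x).
  by rewrite memNset// subr0 mulr1 taboo_in// add0r hA.
rewrite mem_set// subrr mulr0 addr0 taboo_notin//.
rewrite iterS -kop_sub_cst; last exact: bmf_iter.
have bg : bmf (fun y => iter n (kop P) f y - \int[p]_y f y).
  by apply: bmfB; [exact: bmf_iter|exact: bmf_cst].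
apply: (le_trans (bRintegral_abs_le (sprob_kernel_le1 P x) bg)).
by apply: le_kop => //; exact: bmf_norm.
Qed.

Variables (K mu G : R).
Hypothesis surv_le : forall n x, surv n x <= K * mu ^+ n.
Hypothesis murho : rho <= mu.
Hypothesis KG : (1 - rho) * K * mu <= G * (mu - rho).

(** Both sides start at 1. The right side b satisfies b_(n+1) - rho b_n = G (mu - rho) mu^n, which
    by [KG] dominates the source (1 - rho) K mu^(n+1). *)
Lemma discount_le n x : discount n x <= rho ^+ n + G * (mu ^+ n - rho ^+ n).
Proof.
have /andP[r0 r1] := rho01.
elim: n => [|n ih]; first by rewrite !expr0 subrr mulr0 addr0.
rewrite [leLHS]/=; apply: (@le_trans _ _ (rho * (rho ^+ n + G * (mu ^+ n - rho ^+ n)) +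
   (1 - rho) * (K * mu ^+ n.+1))).
  by rewrite lerD// ler_wpM2l ?surv_le ?ih ?subr_ge0 ?(ltW r0) ?(ltW r1).
have : (1 - rho) * K * mu * mu ^+ n <= G * (mu - rho) * mu ^+ n.
  by rewrite ler_wpM2r// exprn_ge0// (le_trans (ltW r0)).
by rewrite !exprS; lra.
Qed.

End hitting_convergence.

(** * Perturbation bounds from a rate of convergence [tau] *)

Section perturbation.
Context d (X : measurableType d) (R : realType).
Variables (P Pt : R.-pker X ~> X) (p pt : probability X R).

Let P1 x : (P x setT <= 1)%E := sprob_kernel_le1 P x.
Let Pt1 x : (Pt x setT <= 1)%E := sprob_kernel_le1 Pt x.

Lemma var_dist_le (mu nu : {measure set X -> \bar R}) (c : R) :
  (mu setT <= 1)%E -> (nu setT <= 1)%E ->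
  (forall f, bmf f -> (forall x, `|f x| <= 1) ->
     `|\int[mu]_x f x - \int[nu]_x f x| <= c) ->
  (var_dist mu nu <= c%:E)%E.
Proof.
move=> mu1 nu1 h; apply: ge_ereal_sup => _ [f [mf f1] <-].
have bf : bmf f by split => //; exists 1.
rewrite -(EFin_Rintegral mu1)// -(EFin_Rintegral nu1)// -EFinB/= lee_fin.
exact: h.
Qed.

Lemma le_var_dist (mu nu : {measure set X -> \bar R}) (f : X -> R) :
  (mu setT <= 1)%E -> (nu setT <= 1)%E -> bmf f -> (forall x, `|f x| <= 1) ->
  (`|\int[mu]_x f x - \int[nu]_x f x|%:E <= var_dist mu nu)%E.
Proof.
move=> mu1 nu1 bf f1; apply: ereal_sup_ubound; exists f.
  by split=> //; case: bf.
by rewrite -(EFin_Rintegral mu1)// -(EFin_Rintegral nu1)// -EFinB.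
Qed.

Lemma kernel_dist_ge0 : (0 <= kernel_dist Pt P)%E.
Proof.
have n1 : forall x : X, `|1 : R| <= 1 by move=> x; rewrite normr1.
apply: (@le_trans _ _ (var_dist (Pt point) (P point))).
  by apply: le_trans (le_var_dist (Pt1 _) (P1 _) (bmf_cst _ 1) n1).
by apply: ereal_sup_ubound; exists point.
Qed.

(** The distance is at most 2, so passing to its real value by [fine] is faithful. *)
Lemma kernel_dist_fin_num : (kernel_dist Pt P \is a fin_num)%E.
Proof.
rewrite ge0_fin_numE ?kernel_dist_ge0// (@le_lt_trans _ _ 2%:E) ?ltry//.
apply: ge_ereal_sup => _ [x _ <-]; apply: var_dist_le => // f bf f1.
rewrite (le_trans (ler_normB _ _))// -[leRHS]/(1 + 1) lerD//.
  exact: bRintegral_norm_le.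
exact: bRintegral_norm_le.
Qed.

Let delta := fine (kernel_dist Pt P).

Lemma kop_dist_le (t : R) f x : bmf f -> (forall y, `|f y| <= t) ->
  `|kop Pt f x - kop P f x| <= t * delta.
Proof.
move=> bf ft.
have t0 : 0 <= t by rewrite (le_trans _ (ft point)).
have unit g : bmf g -> (forall y, `|g y| <= 1) ->
    `|kop Pt g x - kop P g x| <= delta.
  move=> bg g1; rewrite -lee_fin fineK ?kernel_dist_fin_num//.
  apply: (le_trans (le_var_dist (Pt1 x) (P1 x) bg g1)).
  by apply: ereal_sup_ubound; exists x.
(* Rescaling by [t^-1] needs [t] nonzero; for [t = 0] the function is null. *)
move: t0; rewrite le_eqVlt => /predU1P[t0|t0].
  have -> : f = fun=> 0.
    by apply/funext => y; apply/eqP; rewrite -normr_le0 t0.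
  by rewrite !kop_cst subrr normr0 -t0 mul0r.
have bg : bmf (fun y => t^-1 * f y) by exact: bmfZ.
have g1 y : `|t^-1 * f y| <= 1.
  by rewrite normrM gtr0_norm ?invr_gt0// mulrC ler_pdivrMr// mul1r.
have := unit _ bg g1; rewrite /kop (bRintegralZ (Pt1 x))// (bRintegralZ (P1 x))//.
by rewrite -mulrBr normrM gtr0_norm ?invr_gt0// mulrC ler_pdivrMr// mulrC.
Qed.

Variable tau : nat -> R.
Hypothesis tauP : forall n f x, bmf f -> (forall y, `|f y| <= 1) ->
  `|iter n (kop P) f x - \int[p]_y f y| <= tau n.

(** Telescoping by induction. Both operators fix constants, so the limit [c] can be subtracted
    before [Pt] and [P] are compared, and the new term costs [tau n * delta]. *)
Lemma iter_kop_dist_le n f x : bmf f -> (forall y, `|f y| <= 1) ->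
  `|iter n (kop Pt) f x - iter n (kop P) f x| <= (\sum_(i < n) tau i) * delta.
Proof.
move=> bf f1; elim: n x => [|n ih] x.
  by rewrite /= subrr normr0 big_ord0 mul0r.
have bPt := bmf_iter Pt n bf; have bP := bmf_iter P n bf.
set c := \int[p]_y f y.
have bc : bmf (fun y => iter n (kop P) f y - c) by apply: bmfB => //; exact: bmf_cst.
have -> : iter n.+1 (kop Pt) f x - iter n.+1 (kop P) f x =
   (kop Pt (iter n (kop Pt) f) x - kop Pt (iter n (kop P) f) x) +
   (kop Pt (fun y => iter n (kop P) f y - c) x - kop P (fun y => iter n (kop P) f y - c) x).
  by rewrite !kop_sub_cst// !iterS; ring.
rewrite big_ord_recr/= mulrDl (le_trans (ler_normD _ _))// lerD//.
  apply: (bRintegral_dist_le (Pt1 x)) => //.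
  exact: le_trans (normr_ge0 _) (ih point).
by apply: kop_dist_le => // y; exact: tauP.
Qed.

Lemma kernel_dist_kpow_le n :
  (kernel_dist (kpow Pt n) (kpow P n) <= (\sum_(i < n) tau i)%:E * kernel_dist Pt P)%E.
Proof.
rewrite -(fineK kernel_dist_fin_num) -EFinM; apply: ge_ereal_sup => _ [x _ <-].
apply: var_dist_le; [exact: sprob_kernel_le1|exact: sprob_kernel_le1|move=> f bf f1].
by rewrite !Rintegral_kpow//; exact: iter_kop_dist_le.
Qed.

Hypothesis hinvt : invariant_measure Pt pt.

(** Invariance replaces [f] by its [n]-th iterate under [Pt], for any [n]; that iterate is compared
    with the one under [P], then with the mean for [p]. *)
Lemma invariant_dist_le n f : bmf f -> (forall y, `|f y| <= 1) ->
  `|\int[pt]_x f x - \int[p]_x f x| <= (\sum_(i < n) tau i) * delta + tau n.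
Proof.
move=> bf f1; have pt1 : (pt setT <= 1)%E by rewrite probability_setT.
set c := Rintegral p _ _.
have bn := bmf_iter Pt n bf.
have -> : \int[pt]_x f x = \int[pt]_x iter n (kop Pt) f x.
  elim: n {bn} => [//|n ih]; rewrite iterS Rintegral_kop_invariant//; exact: bmf_iter.
have -> : c = \int[pt]_x (fun=> c) x.
  by rewrite Rintegral_cst// [fine _](_ : _ = 1) ?mulr1//= probability_setT.
have h x : `|iter n (kop Pt) f x - c| <= (\sum_(i < n) tau i) * delta + tau n.
  have -> : iter n (kop Pt) f x - c = (iter n (kop Pt) f x - iter n (kop P) f x) +
    (iter n (kop P) f x - c) by ring.
  by rewrite (le_trans (ler_normD _ _))// lerD ?iter_kop_dist_le ?tauP.
apply: (bRintegral_dist_le pt1) => //; first exact: bmf_cst.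
exact: le_trans (normr_ge0 _) (h point).
Qed.

End perturbation.

(** * Constants and conclusion *)

Lemma sum_geometric (R : numFieldType) (x : R) n : x != 1 ->
  \sum_(i < n) x ^+ i = (1 - x)^-1 * (1 - x ^+ n).
Proof.
move=> x1; have x1' : x - 1 != 0 by rewrite subr_eq0.
by rewrite -[1 - x ^+ n]opprB subrX1 -[1 - x]opprB invrN mulrNN mulKf.
Qed.

Local Open Scope ereal_scope.

Theorem theorem3p2 (R : realType)
  (d : measure_display) (X : measurableType d)
  (hX : countably_generated X)
  (P : R.-pker X ~> X) (p : probability X R)
  (hinv : invariant_measure P p)
  (hirr : irreducible P p)
  (hac : forall (n : nat) (x : X), (0 < n)%N -> kpow P n x `<< p)
  (hrev : reversible P p)
  (hpos : nonneg_definite P p)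
  (d' : measure_display) (Omega : measurableType d')
  (PP : X -> probability Omega R) (Phi : nat -> Omega -> X)
  (hPhi : markov_chain P PP Phi)
  (A : set X) (hA : accessible_atom P p A)
  (M : R)
  (hM : ereal_sup (range (fun x : X => \int[PP x]_w hitting_time R Phi A w))
        = M%:E)
  (Pt : R.-pker X ~> X) (pt : probability X R)
  (hinvt : invariant_measure Pt pt)
  (lam : R) (hlam1 : (1 < lam)%R) (hlam2 : (lam < expR M^-1)%R) :
  (forall n : nat, (1 <= n)%N ->
     kernel_dist (kpow Pt n) (kpow P n) <=
       (expR M^-1 / (expR M^-1 - 1) * D1 p A M lam
          * (1 - expR (- (n%:R / M)))
        + lam / (lam - 1) * E1 p A M lam * (1 - lam ^- n))%:E
       * kernel_dist Pt P) /\
  var_dist pt p <=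
    (expR M^-1 / (expR M^-1 - 1) * D1 p A M lam
     + lam / (lam - 1) * E1 p A M lam)%:E
    * kernel_dist Pt P.
Proof.
have [[mA atomA] pA] := hA.
Local Open Scope ring_scope.
set r := expR M^-1 in hlam2 *.
have r1 : 1 < r by rewrite (lt_trans hlam1).
(* Since [0^-1 = 0], the value [M = 0] would give [r = 1]; it is excluded by [1 < lam < r]. *)
have M0 : 0 < M by rewrite -invr_gt0 -expR_gt1.
have l0 : 0 < lam by rewrite (lt_trans ltr01).
have r0 : 0 < r by rewrite expR_gt0.
have rl : 0 < r - lam by rewrite subr_gt0.
pose rho := expR (- M^-1); pose mu := lam^-1.
have rhoE : rho = r^-1 by rewrite /rho expRN.
have rho0 : 0 < rho by rewrite expR_gt0.
have rho1 : rho < 1 by rewrite rhoE invf_lt1.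
have mu0 : 0 < mu by rewrite invr_gt0.
have mu1 : mu < 1 by rewrite invf_lt1.
have rhomu : rho <= mu by rewrite rhoE lef_pV2 ?posrE// ltW.
have lamM : M * ln lam < 1.
  by rewrite mulrC -ltr_pdivlMr// mul1r -[M^-1]expRK ltr_ln ?posrE.
pose K := (1 - M * ln lam)^-1.
have K0 : 0 < K by rewrite invr_gt0 subr_gt0.
have hpsum N x : psum P A N x <= M.
  apply: (sum_surv_le mA hPhi); rewrite -hM; apply: ereal_sup_ubound; by exists x.
have hsurv n x : surv P A n x <= K * mu ^+ n.
  by rewrite /mu exprVn; exact: surv_geometric.
have small e : 0 < e -> exists N, forall x, surv P A N x <= e.
  move=> e0; have [|N hN] := @geometric_small _ mu K e _ (ltW K0) e0.
    by rewrite (ltW mu0).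
  by exists N => x; exact: le_trans (hsurv _ _) hN.
have rhoM : 1 - M^-1 <= rho by exact: expR_ge1Dx.
pose C := C1 p A; have C0 : 0 <= C by exact: sqrtr_ge0.
have hatom (f : X -> R) n x : bmf f -> (forall y, `|f y| <= 1) -> A x ->
    `|iter n.+1 (kop P) f x - \int[p]_y f y| <= C * rho ^+ n.+1.
  by move=> bf f1 Ax; exact: (atom_convergence mA hinv hrev hpos M0 hpsum small rho0 rhoM atomA pA).
(* Solves [G * (mu - rho) = (1 - rho) * K]; since [mu < 1], this gives the inequality required by
   [discount_le]. *)
pose G := (r - 1) / (r - lam) * M1 M lam.
have GE : G * (mu - rho) = (1 - rho) * K.
  by rewrite /G /M1 -/K /mu rhoE; field; rewrite !gt_eqF.
have KG : (1 - rho) * K * mu <= G * (mu - rho).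
  by rewrite GE ler_piMr ?(ltW mu1)// mulr_ge0 ?subr_ge0 ?(ltW rho1) ?(ltW K0).
pose D := D1 p A M lam; pose E := E1 p A M lam.
pose tau n := D * rho ^+ n + E * mu ^+ n.
have tauP n f x : bmf f -> (forall y, `|f y| <= 1) ->
    `|iter n (kop P) f x - \int[p]_y f y| <= tau n.
  move=> bf f1; have rho01 : 0 < rho < 1 by rewrite rho0.
  apply: (le_trans (dist_le_discount mA bf f1 (fun n x => @hatom f n x bf f1) n x)).
  (* Collecting powers shows where the constants come from: [D] is [C * (1 - G)] and [E] is
     [Num.max (2 - C) 0 * K + C * G]. *)
  have -> : tau n = Num.max (2 - C) 0 * (K * mu ^+ n) +
      C * (rho ^+ n + G * (mu ^+ n - rho ^+ n)).
    rewrite /tau /D /E /D1 /E1 -/C -/r -/G /G /M1 -/K.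
    by field; rewrite !gt_eqF.
  rewrite lerD//; last by rewrite ler_wpM2l// (discount_le rho01 hsurv rhomu KG).
  (* [2 - C] may be negative, so the positive part is taken before the upper bound on [surv] is
     used. *)
  apply: (@le_trans _ _ (Num.max (2 - C) 0 * surv P A n x)).
    by rewrite ler_wpM2r ?surv_ge0// le_max lexx.
  by rewrite ler_wpM2l// le_max lexx orbT.
have sum_tau n : \sum_(i < n) tau i =
    r / (r - 1) * D * (1 - rho ^+ n) + lam / (lam - 1) * E * (1 - mu ^+ n).
  rewrite big_split/= -!mulr_sumr !sum_geometric ?lt_eqF//.
  have -> : r / (r - 1) = (1 - rho)^-1.
    by rewrite rhoE; field; rewrite !gt_eqF ?subr_gt0.
  have -> : lam / (lam - 1) = (1 - mu)^-1.
    by rewrite /mu; field; rewrite !gt_eqF ?subr_gt0.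
  ring.
split=> [n _|].
  have := @kernel_dist_kpow_le _ _ _ P Pt p tau tauP n; rewrite sum_tau.
  suff -> : expR (- (n%:R / M)) = rho ^+ n by rewrite -exprVn.
  by rewrite /rho -expRM_natl mulrN.
rewrite -(fineK (kernel_dist_fin_num P Pt)) -EFinM.
set delta := fine _; have delta0 : 0 <= delta by rewrite fine_ge0// kernel_dist_ge0.
have pt1 (q : probability X R) : (q setT <= 1)%E by rewrite probability_setT.
apply: (var_dist_le (pt1 pt) (pt1 p)) => f bf f1; apply/ler_addgt0Pr => e e0.
(* At time [n] the bound is the claimed one plus [a * rho ^+ n + b * mu ^+ n]. The signs of [a] and
   [b] are unknown; as [rho <= mu], the excess is at most [(|a| + |b|) * mu ^+ n], which falls below
   [e]. *)
pose a := D - r / (r - 1) * D * delta; pose b := E - lam / (lam - 1) * E * delta.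
have [|n hn] := @geometric_small _ mu (`|a| + `|b|) e _ (addr_ge0 (normr_ge0 _) (normr_ge0 _)) e0.
  by rewrite (ltW mu0).
apply: (le_trans (invariant_dist_le tauP hinvt n bf f1)); rewrite sum_tau -/delta.
have ha : a * rho ^+ n <= `|a| * mu ^+ n.
  rewrite (le_trans (ler_norm _))// normrM ler_wpM2l// ger0_norm ?exprn_ge0 ?(ltW rho0)//.
  by rewrite lerXn2r// nnegrE ltW.
have hb : b * mu ^+ n <= `|b| * mu ^+ n.
  by rewrite ler_wpM2r ?ler_norm// exprn_ge0// ltW.
have -> : (r / (r - 1) * D * (1 - rho ^+ n) + lam / (lam - 1) * E * (1 - mu ^+ n)) * delta
    + tau n = (r / (r - 1) * D + lam / (lam - 1) * E) * delta + (a * rho ^+ n + b * mu ^+ n).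
  by rewrite /tau /a /b; ring.
rewrite lerD2l (le_trans (lerD ha hb))// -mulrDl//.
Qed.
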